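(* Let $\mathcal A,\mathcal B\in\mathbb{C}^{I_1\times\cdots\times I_N\times I_1\times\cdots\times I_N}$ be random Hermitian tensors and let $\mathcal X\in\mathbb{C}^{I_1\times\cdots\times I_N\times I_1\times\cdots\times I_N}$ be a Hermitian tensor. For two real numbers $\alpha,\beta$ such that $0\le\alpha,\beta\le1$, two positive integers $m,n$, and every $\theta>0$, we have $$\Pr\left(\left\|\mathcal A^{\frac{m(1+\alpha)}2}\star_N\mathcal X\star_N\mathcal B^{\frac{n(1-\alpha)}2}+\mathcal A^{\frac{m(1-\beta)}2}\star_N\mathcal X\star_N\mathcal B^{\frac{n(1+\beta)}2}\right\|\ge\theta\right)\le\frac{(\mathbb{I}_1^N)^2}{\theta}\left[\min_{c>0}\left(\sqrt{2c}\,\|g(t)\|_2+\sqrt{2/c}\,\|g'(t)\|_2\right)\right]\mathbb{E}\left(\left\|\mathcal A^m\star_N\mathcal X+\mathcal X\star_N\mathcal B^n\right\|\right),$$ where $$g(t)=\frac{\exp\left(\frac{\alpha t}2\right)+\exp\left(\frac{-\beta t}2\right)}{\exp\left(\frac t2\right)+\exp\left(\frac{-t}2\right)} .$$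
   Context: $\mathbb{I}_1^N=I_1\cdots I_N$. For square tensors the Einstein product is $(\mathcal X\star_N\mathcal Y)_{i_1\ldots i_N,k_1\ldots k_N}=\sum_{j_1,\ldots,j_N}x_{i_1\ldots i_N,j_1\ldots j_N}y_{j_1\ldots j_N,k_1\ldots k_N}$. Every Hermitian tensor has an eigen-decomposition $\mathcal H=\sum_{i=1}^{\mathbb{I}_1^N}\lambda_i\mathcal P_i$ with eigenvalues $\lambda_i$ and $\mathcal P_i=\mathcal U_i\star_1\mathcal U_i^H$, the $\mathcal U_i\in\mathbb{C}^{I_1\times\cdots\times I_N\times1}$ orthonormal; powers are understood through it, $\mathcal H^p=\sum_i\lambda_i^p\mathcal P_i$. $\|\cdot\|$ on tensors is the spectral norm (largest singular value); $\|\cdot\|_2$ on functions is the $L^2(\mathbb{R})$ norm; $g'$ is the derivative of $g$.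
   Formalization: If m is odd, A is assumed to have nonnegative eigenvalues, and likewise B if n is odd; without this the claim fails (1×1: A=X=1, B=−1, m=n=1, α=β=0). Powers of negative eigenvalues, allowed for even m or n, are principal values; min over c is an infimum, possibly infinite. *)

(* Defs.v *)
From HB Require Import structures.
From mathcomp Require Import all_boot all_order all_algebra.
From mathcomp Require Import complex.
From mathcomp Require Import all_classical all_reals all_analysis.
Set Implicit Arguments.
Unset Strict Implicit.
Unset Printing Implicit Defensive.
Import Order.TTheory GRing.Theory Num.Theory.
Import numFieldNormedType.Exports.
Local Open Scope ring_scope.
Local Open Scope complex_scope.
Local Open Scope classical_set_scope.

(* Library: MathComp and MathComp-Analysis; complex numbers are [R[i]]. *)

Definition mindex (N : nat) (I : 'I_N -> nat) : finType :=
  {dffun forall k : 'I_N, 'I_(I k)}.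

Definition dimI (N : nat) (I : 'I_N -> nat) : nat := (\prod_(k < N) I k)%N.

Section Tensors.
Context {R : realType} {N : nat} {I : 'I_N -> nat}.

(* The entry x_{i_1...i_N,j_1...j_N} is [X (i, j)]. *)
Definition tensor := {ffun mindex I * mindex I -> R[i]}.

(* The trailing mode of size 1 is dropped: I_1 x ... x I_N x 1. *)
Definition tvector := {ffun mindex I -> R[i]}.

Definition einstein (X Y : tensor) : tensor :=
  [ffun ik => \sum_(j : mindex I) X (ik.1, j) * Y (j, ik.2)].

Definition tapply (X : tensor) (u : tvector) : tvector :=
  [ffun i => \sum_(j : mindex I) X (i, j) * u j].

Definition tadjoint (X : tensor) : tensor :=
  [ffun ij => (X (ij.2, ij.1))^*].

Definition thermitian (X : tensor) : Prop := tadjoint X = X.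

Definition tdot (u v : tvector) : R[i] := \sum_(j : mindex I) u j * (v j)^*.

(* u *_1 u^H *)
Definition touter (u : tvector) : tensor := [ffun ij => u ij.1 * (u ij.2)^*].

Definition teigenvalue (X : tensor) (a : R[i]) : Prop :=
  exists u : tvector, u <> 0 /\ tapply X u = a *: u.

Definition tsingular_value (X : tensor) (s : R) : Prop :=
  0 <= s /\ teigenvalue (einstein (tadjoint X) X) (s ^+ 2)%:C.

(* There are finitely many singular values, so the supremum is the largest. *)
Definition tnorm (X : tensor) : R := sup [set s : R | tsingular_value X s].

Definition eigen_decomposition (H : tensor)
    (lam : 'I_(dimI I) -> R) (U : 'I_(dimI I) -> tvector) : Prop :=
  (forall i k, tdot (U i) (U k) = (i == k)%:R) /\
  H = \sum_(i < dimI I) (lam i)%:C *: touter (U i).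

(* Real power of a real number; for x < 0 the principal value
   |x|^p e^(i pi p), which is the usual power when p is an integer.
   At 0, [powR] gives 0^0 = 1 and 0^p = 0 for p > 0. *)
Definition cpow (x p : R) : R[i] :=
  if 0 <= x then (x `^ p)%:C
  else ((- x) `^ p)%:C * (cos (pi * p) +i* sin (pi * p)).

(* The sum does not depend on the eigen-decomposition, so for H Hermitian the
   set below is a singleton; the value 0 is only used if H has none. *)
Definition tpow (H : tensor) (p : R) : tensor :=
  xget 0 [set K : tensor | exists lam U, eigen_decomposition H lam U /\
            K = \sum_(i < dimI I) cpow (lam i) p *: touter (U i)].

(* Needed of A for odd m: with 1 x 1 tensors A = -1, B = X = 1, m odd, n even
   and alpha = beta = 0 one has A^m X + X B^n = 0, whereas
   A^(m/2) X B^(n/2) <> 0 whichever square root of -1 is used.  Likewise for B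
   and odd n.  For even exponents no sign condition is required. *)
Definition nonneg_spectrum (H : tensor) : Prop :=
  forall a : R, teigenvalue H a%:C -> 0 <= a.

Definition random_tensor {d : measure_display} {T : measurableType d}
    (A : T -> tensor) : Prop :=
  forall ij, measurable_fun [set: T] (fun w => complex.Re (A w ij)) /\
             measurable_fun [set: T] (fun w => complex.Im (A w ij)).

Definition random_hermitian {d : measure_display} {T : measurableType d}
    (A : T -> tensor) : Prop :=
  random_tensor A /\ forall w, thermitian (A w).

End Tensors.
Arguments tensor R {N} I.
Arguments tvector R {N} I.

Definition gfun {R : realType} (alpha beta t : R) : R :=
  (expR (alpha * t / 2) + expR (- beta * t / 2)) /
  (expR (t / 2) + expR (- t / 2)).

Definition L2norm {R : realType} (f : R -> R) : \bar R :=
  ('N[lebesgue_measure]_(2%:E) [EFin \o f])%E.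

(* [L2norm] may be +oo (it is for [gfun] when alpha = 1 or beta = 1); the value
   is then +oo. When both norms are positive reals the infimum is attained. *)
Definition min_factor {R : realType} (f : R -> R) : \bar R :=
  ereal_inf [set ((Num.sqrt (2 * c))%:E * L2norm f +
                  (Num.sqrt (2 / c))%:E * L2norm f^`())%E
            | c in [set c : R | 0 < c]].

(* Main.v *)
Require Import Defs.
From HB Require Import structures.
From mathcomp Require Import all_boot all_order all_algebra.
From mathcomp Require Import finmap complex.
From mathcomp Require Import all_classical all_reals all_analysis.
From mathcomp Require Import measurable_realfun ring lra.
Import Order.TTheory GRing.Theory Num.Theory.
Import numFieldNormedType.Exports.
Local Open Scope ring_scope.
Local Open Scope classical_set_scope.

(** The inequality is deterministic up to Markov's inequality. Fix an outcome,
    let [u], [a] and [v], [b] be orthonormal eigenbases and eigenvalues of the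
    two Hermitian tensors, and let [x i j] be the entries of [X] between the
    bases [u] and [v]. Between these bases the tensor inside the probability
    has entries [phi i j * x i j], and the one inside the expectation has
    entries [(a i ^ m + b j ^ n) * x i j]. With [y = |a i| ^ m],
    [z = |b j| ^ n] and [t = ln y - ln z], dividing by the geometric mean of
    [y] and [z] gives [|phi i j| <= g t * (y + z)] when both are positive;
    if one of them vanishes, at most one power survives, with coefficient
    [1 = g 0] ([heinz_scalar]). Hence every entry of the first
    tensor is at most [sup g] times the matching entry of the second. The
    Frobenius norm sees only the moduli of the entries in orthonormal bases
    and is comparable with the spectral norm up to a power of the dimension,
    so the norms compare in the same way ([tnorm_heinz]).

    It remains to see that [sup g] is bounded by the minimum over [c] of
    [sqrt (2 c) |g|_2 + sqrt (2 / c) |g'|_2]. This is a one-dimensional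
    Sobolev inequality ([sobolev_pointwise]): [g t ^ 2 - g s ^ 2] is the
    integral of [2 g g' <= c g ^ 2 + g' ^ 2 / c] over [[s, t]], and [g s] is
    arbitrarily small for suitable [s < t] as soon as [|g|_2] is finite.
    Comparing with the real number [sup g] first also settles the case where
    [|g|_2] is infinite and the expectation vanishes.

    Markov's inequality is only meaningful for random variables, so the powers
    of a random Hermitian tensor and the norm of a random tensor have to be
    shown measurable. The Borel functions are the smallest class that contains
    the constants and the identity and is closed under sums, products and
    pointwise limits ([borel_functions_smallest]). The functions [f] for which
    [f (A w)] is a random tensor form such a class, because the functional
    calculus is multiplicative and the spectrum is finite
    ([random_calculus_real]). Powers are a special case ([random_tpow]); the
    norm of [Y] exceeds [s] exactly when the trace of an indicator function
    applied to [Y^H Y] is positive ([measurable_tnorm]). *)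

Set Implicit Arguments.
Unset Strict Implicit.
Unset Printing Implicit Defensive.

(** * Diagonalization of complex matrices *)

Section UnitaryMatrices.
Local Open Scope complex_scope.
Local Open Scope sesquilinear_scope.
Context {C : numClosedFieldType} {n : nat}.
Implicit Types (u v M A : 'M[C]_n).

Definition diagr (f : 'I_n -> C) : 'M[C]_n := diag_mx (\row_i f i).

Lemma unitary_tCK u : u \is unitarymx -> u^t* *m u = 1%:M.
Proof. by move=> /unitarymxP /mulmx1C. Qed.

(** The spectral theorem, with the eigenvectors as the columns of [u], which is
    the convention of an expansion into the outer products of eigenvectors. *)
Lemma hermitian_diagonalization A : A^t* = A ->
  exists u : 'M[C]_n, exists l : 'I_n -> C,
  [/\ u \is unitarymx, forall k, l k \is Num.real & A = u *m diagr l *m u^t*].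
Proof.
move=> hA.
have hmx : A \is hermsymmx by apply/is_hermitianmxP; rewrite expr0 scale1r hA.
have /orthomx_spectralP e := hermitian_normalmx hmx.
exists ((spectralmx A)^t*), (fun k => spectral_diag A 0 k).
split; first by rewrite trmxC_unitary spectral_unitarymx.
  by move=> k; exact/mxOverP/hermitian_spectral_diag_real.
rewrite trmxCK -invmx_unitary ?spectral_unitarymx// {1}e.
by congr (_ *m diag_mx _ *m _); apply/rowP => k; rewrite mxE.
Qed.

(** The functional calculus does not depend on the diagonalization: entry
    [(i, j)] of [W = v^t* *m u] vanishes unless the eigenvalues [l j] and [m i]
    agree, so [W] intertwines [f \o l] and [f \o m] for every [f]. *)
Lemma diagonal_calculus_unique (T : Type) (g f : T -> C) (l m : 'I_n -> T) u v :
  injective g -> u \is unitarymx -> v \is unitarymx ->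
  u *m diagr (g \o l) *m u^t* = v *m diagr (g \o m) *m v^t* ->
  u *m diagr (f \o l) *m u^t* = v *m diagr (f \o m) *m v^t*.
Proof.
move=> g_inj uU uV e; pose W := v^t* *m u.
have eW : W *m diagr (g \o l) = diagr (g \o m) *m W.
  have := congr1 (fun M => v^t* *m M *m u) e; rewrite !mulmxA unitary_tCK// mul1mx.
  by rewrite -mulmxA unitary_tCK// mulmx1 -mulmxA.
have efW : W *m diagr (f \o l) = diagr (f \o m) *m W.
  apply/matrixP => i j; move/matrixP/(_ i j): eW.
  rewrite /diagr !mul_mx_diag !mul_diag_mx !mxE /= mulrC => /eqP.
  rewrite -subr_eq0 -mulrBl mulf_eq0 subr_eq0 => /orP[/eqP/g_inj ->|/eqP ->].
    by rewrite mulrC.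
  by rewrite mulr0 mul0r.
have uvW : u = v *m W by rewrite /W mulmxA (unitarymxP uV) mul1mx.
have Wu : W *m u^t* = v^t* by rewrite /W -mulmxA (unitarymxP uU) mulmx1.
by rewrite {1}uvW -(mulmxA v) efW -[LHS]mulmxA -(mulmxA _ W) Wu mulmxA.
Qed.

Lemma diagonalized_eigenvalue A u l (x : 'cV[C]_n) a : u \is unitarymx ->
  A = u *m diagr l *m u^t* -> x != 0 -> A *m x = a *: x -> exists k, a = l k.
Proof.
move=> uU eA x0 e; pose y := u^t* *m x.
have xE : x = u *m y by rewrite /y mulmxA (unitarymxP uU) mul1mx.
have y0 : y != 0 by apply: contra_neq x0 => y0; rewrite xE y0 mulmx0.
have [k yk] : exists k, y k 0 != 0.
  apply/not_existsP => h; move/eqP: y0; apply; apply/colP => k.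
  by rewrite [RHS]mxE; apply/eqP/negPn/negP/h.
exists k; have := congr1 (fun z => (u^t* *m z) k 0) e.
rewrite eA -scalemxAr -/y !mulmxA unitary_tCK// mul1mx -mulmxA -/y.
rewrite mul_diag_mx !mxE => e1; by apply: (mulIf yk); rewrite /y mxE.
Qed.

Lemma diagonalized_eigenvector A u l k : u \is unitarymx ->
  A = u *m diagr l *m u^t* -> A *m col k u = l k *: col k u.
Proof.
move=> uU ->; rewrite [in LHS]colE -!mulmxA (mulmxA (u^t*)) unitary_tCK// mul1mx.
rewrite mulmxA -colE; apply/colP => i.
by rewrite mxE mul_mx_diag !mxE mulrC.
Qed.

Lemma unitary_col_neq0 u k : u \is unitarymx -> col k u != 0.
Proof.
move=> uU; apply/eqP => e; have := congr1 (fun M => M k k) (unitary_tCK uU).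
rewrite !mxE eqxx big1 => [/eqP|i _]; first by rewrite eq_sym oner_eq0.
by move/colP/(_ i): e; rewrite !mxE => ->; rewrite mulr0.
Qed.

(** The eigenvalue [l k] is the squared norm of column [k] of [M *m u]. *)
Lemma gram_diagonalization_ge0 M u l : u \is unitarymx ->
  M^t* *m M = u *m diagr l *m u^t* -> forall k, 0 <= l k.
Proof.
move=> uU e k; have -> : l k = ((M *m u)^t* *m (M *m u)) k k.
  rewrite trmx_mul map_mxM mulmxA -(mulmxA _ _ M) e !mulmxA unitary_tCK// mul1mx.
  by rewrite -mulmxA unitary_tCK// mulmx1 !mxE eqxx mulr1n.
by rewrite mxE sumr_ge0 // => j _; rewrite !mxE mulrC mul_conjC_ge0.
Qed.

(** The squared Frobenius norm. *)
Definition fro2 M : C := \sum_i \sum_j `|M i j| ^+ 2.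

Lemma fro2_trace M : fro2 M = \tr (M^t* *m M).
Proof.
rewrite /mxtrace /fro2 exchange_big; apply: eq_bigr => j _; rewrite mxE.
by apply: eq_bigr => i _; rewrite !mxE normCK mulrC.
Qed.

Lemma fro2_unitary u v M : u \is unitarymx -> v \is unitarymx ->
  fro2 (u *m M *m v^t*) = fro2 M.
Proof.
move=> hu hv; rewrite !fro2_trace !trmx_mul !map_mxM trmxCK.
rewrite -!mulmxA (mulmxA (u^t*)) unitary_tCK// mul1mx.
by rewrite mxtrace_mulC -!mulmxA (unitary_tCK hv) mulmx1.
Qed.

Lemma fro2_diagonalization M u l : u \is unitarymx ->
  M^t* *m M = u *m diagr l *m u^t* -> fro2 M = \sum_k l k.
Proof.
move=> uU e; rewrite fro2_trace e mxtrace_mulC mulmxA unitary_tCK// mul1mx.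
by rewrite mxtrace_diag; apply: eq_bigr => k _; rewrite mxE.
Qed.

Lemma fro2_le (S : C) (y z : 'M[C]_n) :
  0 <= S -> (forall i j, `|y i j| <= S * `|z i j|) ->
  fro2 y <= S ^+ 2 * fro2 z.
Proof.
move=> S0 hyz; rewrite /fro2 mulr_sumr ler_sum// => i _.
rewrite mulr_sumr ler_sum// => j _.
by rewrite -exprMn lerXn2r ?nnegrE ?mulr_ge0.
Qed.

(** Between the bases [u] and [v] both tensors are entrywise multiples of the
    same matrix [x], and the Frobenius norm can be computed in these bases. *)
Lemma fro2_double_multiplier (S : C) u v M A1 A2 A3 B1 B2 B3
    (a1 a2 a3 b1 b2 b3 : 'I_n -> C) :
  0 <= S -> u \is unitarymx -> v \is unitarymx ->
  A1 = u *m diagr a1 *m u^t* -> A2 = u *m diagr a2 *m u^t* ->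
  A3 = u *m diagr a3 *m u^t* -> B1 = v *m diagr b1 *m v^t* ->
  B2 = v *m diagr b2 *m v^t* -> B3 = v *m diagr b3 *m v^t* ->
  (forall i j, `|a1 i * b1 j + a2 i * b2 j| <= S * `|a3 i + b3 j|) ->
  fro2 (A1 *m M *m B1 + A2 *m M *m B2) <= S ^+ 2 * fro2 (A3 *m M + M *m B3).
Proof.
move=> S0 uU uV -> -> -> -> -> -> hS; pose x := u^t* *m M *m v.
have two p q : u *m p *m u^t* *m M *m (v *m q *m v^t*) = u *m (p *m x *m q) *m v^t*.
  by rewrite /x !mulmxA.
have left p : u *m p *m u^t* *m M = u *m (p *m x) *m v^t*.
  by rewrite /x !mulmxA -[RHS]mulmxA (unitarymxP uV) mulmx1.
have right q : M *m (v *m q *m v^t*) = u *m (x *m q) *m v^t*.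
  by rewrite /x !mulmxA (unitarymxP uU) mul1mx.
clearbody x; rewrite !two left right -!mulmxDl -!mulmxDr !fro2_unitary//.
apply: fro2_le => // i j.
rewrite /diagr !mul_mx_diag !mul_diag_mx !mxE (mulrC (x i j) (b3 j)) -mulrDl.
by rewrite (mulrAC (a1 i)) (mulrAC (a2 i)) -mulrDl !normrM mulrA ler_wpM2r.
Qed.
End UnitaryMatrices.

(** * Tensors as square matrices *)

Lemma card_mindex (N : nat) (I : 'I_N -> nat) : #|mindex I| = dimI I.
Proof.
rewrite card_dep_ffun foldrE big_map big_enum /=.
by apply: eq_bigr => k _; rewrite card_ord.
Qed.

Section TensorMatrix.
Local Open Scope complex_scope.
Local Open Scope sesquilinear_scope.
Context {R : realType} {N : nat} {I : 'I_N -> nat}.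
Local Notation C := R[i].
Local Notation D := (dimI I).
Implicit Types (X Y H : tensor R I) (lam : 'I_D -> R) (U : 'I_D -> tvector R I).

(** An enumeration of the multi-indices by the index set of the eigenvalues, so
    that tensors and their eigenvector matrices are square of the same type. *)
Definition tidx (k : 'I_D) : mindex I := enum_val (cast_ord (esym (card_mindex I)) k).

Lemma tidx_bij : bijective tidx.
Proof.
apply: bij_comp; first exact: enum_val_bij.
exact: (Bijective (cast_ordK _) (cast_ordKV _)).
Qed.

Definition tmx X : 'M[C]_D := \matrix_(i, j) X (tidx i, tidx j).

Lemma tmx_inj : injective tmx.
Proof.
move=> X Y /matrixP e; apply/ffunP => -[i j].
have [f fK Kf] := tidx_bij.
by have := e (f i) (f j); rewrite !mxE !Kf.
Qed.

Lemma tmxD X Y : tmx (X + Y) = tmx X + tmx Y.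
Proof. by apply/matrixP => i j; rewrite !mxE ffunE. Qed.

Lemma tmx_einstein X Y : tmx (einstein X Y) = tmx X *m tmx Y.
Proof.
apply/matrixP => i j; rewrite !mxE ffunE /= (reindex tidx) /=; last first.
  exact/onW_bij/tidx_bij.
by apply: eq_bigr => k _; rewrite !mxE.
Qed.

Lemma tmx_adjoint X : tmx (tadjoint X) = (tmx X)^t*.
Proof. by apply/matrixP => i j; rewrite !mxE ffunE. Qed.

Definition ucols U : 'M[C]_D := \matrix_(i, k) U k (tidx i).

Lemma tmx_outer_sum (f : 'I_D -> C) U :
  tmx (\sum_(i < D) f i *: touter (U i)) = ucols U *m diagr f *m (ucols U)^t*.
Proof.
apply/matrixP => i j; rewrite mxE sum_ffunE mxE; apply: eq_bigr => k _.
rewrite !ffunE /= mul_mx_diag !mxE /=.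
by rewrite -[LHS]/(f k * (_ * _)) mulrA (mulrC (f k)).
Qed.

Lemma tdotE U i k : tdot (U i) (U k) = ((ucols U)^t* *m ucols U) k i.
Proof.
rewrite /tdot (reindex tidx) /=; last exact/onW_bij/tidx_bij.
by rewrite mxE; apply: eq_bigr => j _; rewrite !mxE mulrC.
Qed.

Lemma eigen_decompositionP H lam U : eigen_decomposition H lam U <->
  ucols U \is unitarymx /\
  tmx H = ucols U *m diagr (real_complex R \o lam) *m (ucols U)^t*.
Proof.
split=> -[hU hH]; split.
- rewrite -trmxC_unitary; apply/unitarymxP; rewrite trmxCK.
  by apply/matrixP => i k; rewrite -tdotE hU mxE eq_sym.
- by rewrite hH tmx_outer_sum.
- by move=> i k; rewrite tdotE unitary_tCK// mxE eq_sym.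
- by apply: tmx_inj; rewrite tmx_outer_sum.
Qed.

Lemma ucols_surj (u : 'M[C]_D) : exists U, ucols U = u.
Proof.
have [f fK Kf] := tidx_bij.
exists (fun k => [ffun i => u (f i) k]).
by apply/matrixP => i k; rewrite !mxE ffunE fK.
Qed.

Lemma eigen_decomposition_exists H : thermitian H ->
  exists lam U, eigen_decomposition H lam U.
Proof.
move=> hH.
have [|u [l [uU lr e]]] := @hermitian_diagonalization _ _ (tmx H).
  by rewrite -tmx_adjoint hH.
have [U hU] := ucols_surj u.
have el : real_complex R \o (fun k => complex.Re (l k)) = l.
  by apply/funext => k /=; rewrite RRe_real.
exists (fun k => complex.Re (l k)), U; apply/eigen_decompositionP.
by rewrite hU el.
Qed.

Lemma eigen_calculus_unique H lam U mu V (f : R -> C) :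
  eigen_decomposition H lam U -> eigen_decomposition H mu V ->
  \sum_(i < D) f (lam i) *: touter (U i) = \sum_(i < D) f (mu i) *: touter (V i).
Proof.
move=> /eigen_decompositionP[uU eU] /eigen_decompositionP[uV eV].
have e := @diagonal_calculus_unique _ _ _ _ f lam mu _ _ (@complexI R) uU uV.
apply: tmx_inj; rewrite [LHS](tmx_outer_sum (f \o lam)).
rewrite [RHS](tmx_outer_sum (f \o mu)).
by apply: e; rewrite -eU -eV.
Qed.

(** [tpow] picks an arbitrary eigen-decomposition; by uniqueness of the calculus
    it may be computed in any other one, in particular one that is shared by all
    exponents. *)
Lemma tpowE H lam U p : eigen_decomposition H lam U ->
  tpow H p = \sum_(i < D) cpow (lam i) p *: touter (U i).
Proof.
move=> hH; rewrite /tpow; case: xgetP => [K _ [mu [V [hV ->]]]|].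
  exact: (eigen_calculus_unique (fun x => cpow x p) hV hH).
by move=> /(_ (\sum_(i < D) cpow (lam i) p *: touter (U i)))[]; exists lam, U.
Qed.

Definition tcol (v : tvector R I) : 'cV[C]_D := \col_i v (tidx i).

Lemma tcol_inj : injective tcol.
Proof.
move=> v w /colP e; apply/ffunP => i; have [f fK Kf] := tidx_bij.
by have := e (f i); rewrite !mxE Kf.
Qed.

Lemma tcol0 : tcol 0 = 0.
Proof. by apply/colP => i; rewrite !mxE ffunE. Qed.

Lemma tcol_tapply X v : tcol (tapply X v) = tmx X *m tcol v.
Proof.
apply/colP => i; rewrite !mxE ffunE /= (reindex tidx) /=; last first.
  exact/onW_bij/tidx_bij.
by apply: eq_bigr => k _; rewrite !mxE.
Qed.

Lemma tcolZ a v : tcol (a *: v) = a *: tcol v.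
Proof. by apply/colP => i; rewrite !mxE ffunE. Qed.

Lemma tcol_col U k : tcol (U k) = col k (ucols U).
Proof. by apply/colP => i; rewrite !mxE. Qed.

Lemma teigenvalueP H lam U (a : C) : eigen_decomposition H lam U ->
  teigenvalue H a <-> exists k, a = (lam k)%:C.
Proof.
move=> /eigen_decompositionP[uU eU].
split=> [[v [v0 /(congr1 tcol)]]|[k ->]].
  rewrite tcol_tapply tcolZ => e; apply: (diagonalized_eigenvalue uU eU _ e).
  by apply/eqP => v0'; apply/v0/tcol_inj; rewrite v0' tcol0.
exists (U k); split.
  by move=> /(congr1 tcol); rewrite tcol_col tcol0; apply/eqP/unitary_col_neq0.
apply: tcol_inj; rewrite tcol_tapply tcolZ tcol_col.
exact: (diagonalized_eigenvector k uU eU).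
Qed.

Definition tgram Y : tensor R I := einstein (tadjoint Y) Y.

Lemma tmx_gram Y : tmx (tgram Y) = (tmx Y)^t* *m tmx Y.
Proof. by rewrite tmx_einstein tmx_adjoint. Qed.

Lemma tgram_hermitian Y : thermitian (tgram Y).
Proof.
apply: tmx_inj; rewrite tmx_adjoint tmx_gram.
by rewrite trmx_mul map_mxM trmxCK.
Qed.

Lemma tgram_eigen_ge0 Y mu V : eigen_decomposition (tgram Y) mu V ->
  forall k, 0 <= mu k.
Proof.
move=> /eigen_decompositionP[uV]; rewrite tmx_gram => e k.
by rewrite -ler0c; exact: (gram_diagonalization_ge0 uV e k).
Qed.

Lemma tsingular_valueP Y mu V s : eigen_decomposition (tgram Y) mu V ->
  tsingular_value Y s <-> exists k, s = Num.sqrt (mu k).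
Proof.
move=> hY; have mu0 := tgram_eigen_ge0 hY; split.
  move=> [s0 /(teigenvalueP _ hY)[k /complexI e]]; exists k.
  by rewrite -e sqrtr_sqr ger0_norm.
move=> [k ->]; split; first exact: sqrtr_ge0.
by apply/(teigenvalueP _ hY); exists k; rewrite sqr_sqrtr.
Qed.

(** The singular values are the square roots of the finitely many eigenvalues of
    [Y^H Y], so their supremum is attained. *)
Lemma tnorm_attained Y mu V : (0 < D)%N -> eigen_decomposition (tgram Y) mu V ->
  (forall k, Num.sqrt (mu k) <= tnorm Y) /\ exists k, tnorm Y = Num.sqrt (mu k).
Proof.
move=> D_gt0 hY; have hs s := tsingular_valueP s hY.
pose k0 : 'I_D := Ordinal D_gt0.
have [kmax _ hmax] := 
  @Order.TotalTheory.arg_maxP _ R 'I_D k0 xpredT (fun k => Num.sqrt (mu k)) isT.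
have ub : ubound [set s | tsingular_value Y s] (Num.sqrt (mu kmax)).
  by move=> s /= /hs[k ->]; exact: hmax.
have e : tnorm Y = Num.sqrt (mu kmax).
  apply/eqP; rewrite eq_le; apply/andP; split.
    by apply: ge_sup => //; exists (Num.sqrt (mu k0)); apply/hs; exists k0.
  by apply: ub_le_sup; [exists (Num.sqrt (mu kmax)) | apply/hs; exists kmax].
by split; [move=> k; rewrite e; exact: hmax | exists kmax].
Qed.

Hypothesis D_gt0 : (0 < D)%N.

Lemma tnorm_ge0 Y : 0 <= tnorm Y.
Proof.
have [mu [V /(tnorm_attained D_gt0)[_ [k ->]]]] :=
  eigen_decomposition_exists (tgram_hermitian Y).
exact: sqrtr_ge0.
Qed.

(** The squared Frobenius norm is the trace of [Y^H Y], a sum of [D] nonnegative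
    eigenvalues the largest of which is the squared spectral norm. *)
Lemma fro2_tnorm Y :
  ((tnorm Y) ^+ 2)%:C <= fro2 (tmx Y) <= (D%:R * (tnorm Y) ^+ 2)%:C.
Proof.
have [mu [V hY]] := eigen_decomposition_exists (tgram_hermitian Y).
have mu0 := tgram_eigen_ge0 hY.
have [ub [k0 e]] := tnorm_attained D_gt0 hY.
have -> : fro2 (tmx Y) = (\sum_k mu k)%:C.
  have /eigen_decompositionP[uV eV] := hY; rewrite tmx_gram in eV.
  by rewrite (fro2_diagonalization uV eV) rmorph_sum.
rewrite !lecR; apply/andP; split.
  by rewrite e sqr_sqrtr// (bigD1 k0)//= lerDl sumr_ge0.
rewrite mulr_natl -[in X in _ *+ X](card_ord D) -sumr_const ler_sum// => k _.
by rewrite -[mu k]sqr_sqrtr// lerXn2r ?nnegrE ?sqrtr_ge0 ?tnorm_ge0.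
Qed.

Lemma tnorm_le_fro2 Y Z (S : R) : 0 <= S ->
  fro2 (tmx Y) <= S%:C ^+ 2 * fro2 (tmx Z) ->
  tnorm Y <= D%:R ^+ 2 * S * tnorm Z.
Proof.
move=> S0 hYZ.
have D1 : 1 <= D%:R :> R by rewrite ler1n.
have rhs0 : 0 <= D%:R ^+ 2 * S * tnorm Z by rewrite !mulr_ge0 ?tnorm_ge0.
rewrite -(@ler_pXn2r _ 2) ?nnegrE ?tnorm_ge0// -lecR.
have /andP[+ _] := fro2_tnorm Y; move/le_trans; apply.
have /andP[_ hZn] := fro2_tnorm Z.
have SC : 0 <= S%:C by rewrite ler0c.
apply: (le_trans hYZ).
apply: (le_trans (ler_wpM2l (exprn_ge0 2 SC) hZn)).
rewrite -rmorphXn -rmorphM lecR mulrA !exprMn ler_wpM2r ?sqr_ge0//.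
rewrite mulrC ler_wpM2r ?sqr_ge0// -exprD.
by rewrite -[leLHS]expr1 ler_weXn2l.
Qed.

(** The entries between the two eigenbases are compared one by one; the passage
    to the Frobenius norm and back only costs a power of the dimension. *)
Lemma tnorm_double_multiplier (S : R) X A1 A2 A3 B1 B2 B3 U V
    (a1 a2 a3 b1 b2 b3 : 'I_D -> C) :
  0 <= S -> ucols U \is unitarymx -> ucols V \is unitarymx ->
  A1 = \sum_(i < D) a1 i *: touter (U i) ->
  A2 = \sum_(i < D) a2 i *: touter (U i) ->
  A3 = \sum_(i < D) a3 i *: touter (U i) ->
  B1 = \sum_(i < D) b1 i *: touter (V i) ->
  B2 = \sum_(i < D) b2 i *: touter (V i) ->
  B3 = \sum_(i < D) b3 i *: touter (V i) ->
  (forall i j, `|a1 i * b1 j + a2 i * b2 j| <= S%:C * `|a3 i + b3 j|) ->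
  tnorm (einstein (einstein A1 X) B1 + einstein (einstein A2 X) B2) <=
  D%:R ^+ 2 * S * tnorm (einstein A3 X + einstein X B3).
Proof.
move=> S0 uU uV hA1 hA2 hA3 hB1 hB2 hB3 hS.
have SC : 0 <= S%:C by rewrite ler0c.
have tE Z W (f : 'I_D -> C) : Z = \sum_(i < D) f i *: touter (W i) ->
  tmx Z = ucols W *m diagr f *m (ucols W)^t* by move=> ->; exact: tmx_outer_sum.
apply: (tnorm_le_fro2 S0); rewrite !tmxD !tmx_einstein.
exact: (fro2_double_multiplier (tmx X) SC uU uV (tE _ _ _ hA1) (tE _ _ _ hA2)
  (tE _ _ _ hA3) (tE _ _ _ hB1) (tE _ _ _ hB2) (tE _ _ _ hB3) hS).
Qed.
End TensorMatrix.

(** * The class of Borel functions *)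

Section BorelFunctions.
Import HBSimple HBNNSimple.

(** The class contains the exponentials of its members, as limits of Taylor
    polynomials. The functions [exp (- (exp (a - x)) ^ n)] tend to [1], [exp (-1)]
    or [0] according to the sign of [x - a], and powers of this limit tend to the
    indicator of the ray above [a]. The sets with indicator in the class form a
    sigma-algebra, hence contain all Borel sets, and simple functions approximate
    every Borel function. *)
Lemma borel_functions_smallest (R : realType) (F : set (R -> R)) :
  F id -> (forall k : R, F (fun=> k)) ->
  (forall f g, F f -> F g -> F (fun x => f x + g x)) ->
  (forall f g, F f -> F g -> F (fun x => f x * g x)) ->
  (forall (h : nat -> R -> R) f, (forall n, F (h n)) ->
     (forall x, h n x @[n --> \oo] --> f x) -> F f) ->
  forall f, measurable_fun [set: R] f -> F f.
Proof.
move=> Fid Fcst FD FM Flim.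
have FX f n : F f -> F (fun x => f x ^+ n).
  move=> Ff; elim: n => [|n IH].
    by rewrite (_ : (fun _ => _) = (fun=> 1))//; apply/funext => x; rewrite expr0.
  rewrite (_ : (fun _ => _) = (fun x => f x * f x ^+ n)); first exact: (FM).
  by apply/funext => x; rewrite exprS.
have Fsum (I : Type) (s : seq I) (f : I -> R -> R) : (forall i, F (f i)) ->
    F (fun x => \sum_(i <- s) f i x).
  move=> Ff; elim: s => [|i s IH].
    by rewrite (_ : (fun _ => _) = (fun=> 0))//; apply/funext => x; rewrite big_nil.
  rewrite (_ : (fun _ => _) =
      (fun x => f i x + \sum_(j <- s) f j x)); first exact: (FD).
  by apply/funext => x; rewrite big_cons.
have Fexp f : F f -> F (fun x => expR (f x)).
  move=> Ff; apply: (Flim (fun n x => series (exp_coeff (f x)) n)).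
    move=> n; apply: Fsum => k; rewrite /exp_coeff.
    by apply: (FM) => //; exact: (FX).
  by move=> x; exact: is_cvg_series_exp_coeff.
have Fray a : F (\1_(`]a, +oo[ : set R)).
  (* The value exp (-1) at the endpoint is below 1, so that powers kill it. *)
  pose H x : R := if a < x then 1 else if x == a then expR (-1) else 0.
  have FH : F H.
    apply: (Flim (fun n x => expR (- 1 * expR (a + -1 * x) ^+ n))).
      move=> n; apply: (Fexp); apply: (FM) => //; apply: (FX); apply: (Fexp).
      by apply: (FD) => //; apply: (FM).
    move=> x; rewrite /H; set q := expR _.
    have q0 : 0 < q by exact: expR_gt0.
    case: ltgtP => ax.
    - have cq : (fun n => -1 * q ^+ n) @ \oo --> -1 * (0 : R).
        apply: cvgMr; apply: cvg_expr.
        by rewrite gtr0_norm// -(expR0 R) ltr_expR mulN1r subr_lt0.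
      have := cvg_comp _ _ cq (@continuous_expR R _).
      by rewrite mulr0 expR0.
    - apply: (@squeeze_cvgr _ _ _ _ (fun=> 0) (fun n => (q^-1) ^+ n)).
      + apply: nearW => n; rewrite expR_ge0/= mulN1r expRN exprVn.
        rewrite lef_pV2 ?posrE ?expR_gt0 ?exprn_gt0//.
        by apply: le_trans (expR_ge1Dx _); rewrite lerDr.
      + exact: cvg_cst.
      + apply: cvg_expr; rewrite gtr0_norm ?invr_gt0// invf_lt1//.
        by rewrite -expR0 ltr_expR mulN1r subr_gt0.
    - apply: cvg_near_cst; apply: nearW => n.
      by rewrite /q ax (mulN1r x) subrr expR0 expr1n mulr1.
  apply: (Flim (fun n x => H x ^+ n)) => [n|x]; first exact: (FX).
  rewrite indicE mem_setE in_itv/= andbT /H.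
  case: ltgtP => ax.
  - by under eq_fun do rewrite expr1n; exact: cvg_cst.
  - by apply: cvg_expr; rewrite normr0.
  - have : expR (-1) < expR 0 :> R by rewrite ltr_expR ltrN10.
    by rewrite expR0 => e1; apply: cvg_expr; rewrite gtr0_norm ?expR_gt0.
have Fset (E : set R) : measurable E -> F (\1_E).
  have : <<s @RGenOInfty.G R >> `<=` [set E | F (\1_E)]; last first.
    move=> sub mE; apply: sub.
    by have : ((@ocitv R).-sigma.-measurable) E by []; rewrite RGenOInfty.measurableE.
  apply: smallest_sub; last by move=> _ [x ->]; exact: (Fray).
  have FC A : F (\1_A) -> F (\1_(~` A)).
    move=> FA; rewrite (_ : \1_ _ = (fun x => 1 + -1 * \1_A x)).
      by apply: (FD) => //; exact: (FM).
    by apply/funext => x; rewrite !indicE in_setC mulN1r; case: (_ \in _);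
      rewrite ?subrr ?subr0.
  split => /=.
  - by rewrite indic0; exact: Fcst.
  - by move=> A FA; rewrite setTD; exact: (FC).
  - move=> A FA.
    have FU n : F (\1_(\bigcup_(i < n) A i)).
      elim: n => [|n IH].
        by rewrite bigcup_mkord big_ord0 indic0; exact: Fcst.
      rewrite bigcup_mkord big_ord_recr/= -bigcup_mkord.
      set B := \bigcup_(_ in _) _ in IH *.
      rewrite (_ : \1_ _ = (fun x => \1_B x + \1_(A n) x + -1 * (\1_B x * \1_(A n) x))).
        apply: (FD); first exact: (FD).
        by apply: (FM) => //; exact: (FM).
      apply/funext => x; rewrite !indicE in_setU.
      by case: (_ \in _); case: (_ \in _);
        rewrite /= ?mulr1 ?mulr0 ?addr0 ?add0r ?addrK.
    apply: (Flim _ _ FU) => x; rewrite [in X in _ --> X]indicE.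
    have [[n _ An]|h] := pselect ((\bigcup_i A i) x).
      rewrite mem_set; last by exists n.
      apply: cvg_near_cst; exists n.+1 => // m /= nm.
      by rewrite indicE mem_set//; exists n.
    rewrite memNset//; apply: cvg_near_cst; apply: nearW => m.
    by rewrite indicE memNset// => -[i _ Ai]; apply: h; exists i.
have Fge0 (g : R -> R) : measurable_fun setT g -> (forall x, 0 <= g x) -> F g.
  move=> mg g0; have mEg : measurable_fun setT (EFin \o g) by exact/measurable_EFinP.
  refine (Flim (fun n (x : R) => nnsfun_approx measurableT mEg n x : R) g _ _).
    move=> n; set s := nnsfun_approx _ _ _.
    rewrite (_ : (s : R -> R) =
      (fun x => \sum_(y <- fset_set (range s)) y * \1_(s @^-1` [set y]) x)).
      by apply: Fsum => y; apply: (FM) => //; apply: (Fset); exact: measurable_sfunP.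
    by apply/funext => x; rewrite fimfunE fsbig_finite//; exact: fimfunP.
  move=> x; have Eg0 y : setT y -> (0 <= (EFin \o g) y)%E by rewrite lee_fin.
  exact: fine_cvg (@cvg_nnsfun_approx _ _ _ _ measurableT _ mEg Eg0 x Logic.I).
move=> f mf.
rewrite -[f]funrposBneg (_ : _ - _ = (fun x => f^\+ x + -1 * f^\- x)); last first.
  by apply/funext => x; rewrite mulN1r.
apply: (FD); first by apply: (Fge0) => //; exact: measurable_funrpos.
by apply: (FM) => //; apply: (Fge0) => //; exact: measurable_funrneg.
Qed.
End BorelFunctions.

(** * Measurability of powers and norms of random tensors *)

Section RandomTensors.
Local Open Scope complex_scope.
Local Open Scope sesquilinear_scope.
Context {R : realType} {N : nat} {I : 'I_N -> nat}.
Context {d : measure_display} {T : measurableType d}.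
Local Notation C := R[i].
Local Notation D := (dimI I).

Definition measurable_complex (f : T -> C) : Prop :=
  measurable_fun [set: T] (fun w => complex.Re (f w)) /\
  measurable_fun [set: T] (fun w => complex.Im (f w)).

Lemma measurable_complexD f g : measurable_complex f -> measurable_complex g ->
  measurable_complex (fun w => f w + g w).
Proof.
move=> [rf imf] [rg img]; split.
- rewrite (_ : (fun _ => _) = (fun w => complex.Re (f w) + complex.Re (g w))).
    exact: measurable_funD.
  by apply/funext => w; case: (f w) (g w) => ? ? [].
- rewrite (_ : (fun _ => _) = (fun w => complex.Im (f w) + complex.Im (g w))).
    exact: measurable_funD.
  by apply/funext => w; case: (f w) (g w) => ? ? [].
Qed.

Lemma measurable_complexM f g : measurable_complex f -> measurable_complex g ->
  measurable_complex (fun w => f w * g w).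
Proof.
move=> [rf imf] [rg img]; split.
- rewrite (_ : (fun _ => _) = (fun w => complex.Re (f w) * complex.Re (g w) -
      complex.Im (f w) * complex.Im (g w))).
    by apply: measurable_funB; exact: measurable_funM.
  by apply/funext => w; case: (f w) (g w) => ? ? [].
- rewrite (_ : (fun _ => _) = (fun w => complex.Re (f w) * complex.Im (g w) +
      complex.Im (f w) * complex.Re (g w))).
    by apply: measurable_funD; exact: measurable_funM.
  by apply/funext => w; case: (f w) (g w) => ? ? [].
Qed.

Lemma measurable_complex_cst z : measurable_complex (fun=> z).
Proof. by split; exact: measurable_cst. Qed.

Lemma measurable_complex_sum (J : Type) (s : seq J) (f : J -> T -> C) :
  (forall j, measurable_complex (f j)) ->
  measurable_complex (fun w => \sum_(j <- s) f j w).
Proof.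
move=> mf; elim: s => [|j s IH].
  rewrite (_ : (fun _ => _) = (fun=> 0)); first exact: measurable_complex_cst.
  by apply/funext => w; rewrite big_nil.
rewrite (_ : (fun _ => _) = (fun w => f j w + \sum_(i <- s) f i w)).
  exact: measurable_complexD.
by apply/funext => w; rewrite big_cons.
Qed.

Lemma measurable_complex_conj f : measurable_complex f ->
  measurable_complex (fun w => (f w)^*).
Proof.
move=> [rf imf]; split.
- by rewrite (_ : (fun _ => _) = (fun w => complex.Re (f w)))//;
    apply/funext => w; case: (f w).
- rewrite (_ : (fun _ => _) = (fun w => - complex.Im (f w))).
    exact: measurable_funN.
  by apply/funext => w; case: (f w).
Qed.

Lemma eq_random_tensor (X : T -> tensor R I) (f : mindex I * mindex I -> T -> C) :
  (forall w ij, X w ij = f ij w) -> (forall ij, measurable_complex (f ij)) ->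
  random_tensor X.
Proof.
move=> e mf ij; have := mf ij; rewrite (_ : f ij = fun w => X w ij)//.
by apply/funext => w; rewrite e.
Qed.

Lemma random_tensor_cst (X : tensor R I) : random_tensor (fun _ : T => X).
Proof. by move=> ij; exact: measurable_complex_cst. Qed.

Lemma random_tensorD (X Y : T -> tensor R I) : random_tensor X ->
  random_tensor Y -> random_tensor (fun w => X w + Y w).
Proof.
move=> mX mY; apply: (@eq_random_tensor _ (fun ij w => X w ij + Y w ij)).
  by move=> w ij; rewrite ffunE.
by move=> ij; exact: (measurable_complexD (mX ij) (mY ij)).
Qed.

Lemma random_tensorZ z (X : T -> tensor R I) : random_tensor X ->
  random_tensor (fun w => z *: X w).
Proof.
move=> mX; apply: (@eq_random_tensor _ (fun ij w => z * X w ij)).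
  by move=> w ij; rewrite ffunE.
by move=> ij; exact: (measurable_complexM (measurable_complex_cst z) (mX ij)).
Qed.

Lemma random_tensor_einstein (X Y : T -> tensor R I) : random_tensor X ->
  random_tensor Y -> random_tensor (fun w => einstein (X w) (Y w)).
Proof.
move=> mX mY; apply: (@eq_random_tensor _
    (fun ij w => \sum_k X w (ij.1, k) * Y w (k, ij.2))).
  by move=> w ij; rewrite ffunE.
move=> ij; apply: measurable_complex_sum => k.
exact: (measurable_complexM (mX (ij.1, k)) (mY (k, ij.2))).
Qed.

Lemma random_tensor_adjoint (X : T -> tensor R I) : random_tensor X ->
  random_tensor (fun w => tadjoint (X w)).
Proof.
move=> mX; apply: (@eq_random_tensor _ (fun ij w => (X w (ij.2, ij.1))^*)).
  by move=> w ij; rewrite ffunE.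
by move=> ij; exact: (measurable_complex_conj (mX (ij.2, ij.1))).
Qed.

Section Calculus.
Variables (lam : T -> 'I_D -> R) (U : T -> 'I_D -> tvector R I).
Hypothesis uU : forall w, ucols (U w) \is unitarymx.

Definition calculus (f : R -> C) (w : T) : tensor R I :=
  \sum_(i < D) f (lam w i) *: touter (U w i).

Lemma tmx_calculus f w : tmx (calculus f w) =
  ucols (U w) *m diagr (f \o lam w) *m (ucols (U w))^t*.
Proof. exact: (tmx_outer_sum (f \o lam w)). Qed.

(** The eigenvectors are orthonormal, so the cross terms of the product vanish. *)
Lemma calculusM f g w :
  calculus (fun x => f x * g x) w = einstein (calculus f w) (calculus g w).
Proof.
apply: tmx_inj; rewrite tmx_einstein !tmx_calculus.
rewrite -!mulmxA (mulmxA ((ucols (U w))^t*)) (unitary_tCK (uU w)) mul1mx.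
congr (_ *m _); rewrite mulmxA; congr (_ *m _).
apply/matrixP => i j; rewrite mul_diag_mx !mxE /=.
by case: eqP => [->|]; rewrite ?mulr1n ?mulr0n ?mulr0.
Qed.

Lemma calculusD f g w :
  calculus (fun x => f x + g x) w = calculus f w + calculus g w.
Proof.
by rewrite /calculus -big_split; apply: eq_bigr => i _; rewrite scalerDl.
Qed.

Lemma calculusZ z f w : calculus (fun x => z * f x) w = z *: calculus f w.
Proof.
by rewrite /calculus scaler_sumr; apply: eq_bigr => i _; rewrite scalerA.
Qed.

Lemma calculus1 w : calculus (fun=> 1) w = [ffun ij => (ij.1 == ij.2)%:R].
Proof.
apply: tmx_inj; rewrite tmx_calculus.
rewrite (_ : diagr _ = 1%:M); last first.
  by apply/matrixP => i j; rewrite !mxE.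
rewrite mulmx1 (unitarymxP (uU w)); apply/matrixP => i j.
by rewrite !mxE ffunE /= (inj_eq (bij_inj tidx_bij)).
Qed.

(** The eigenvalues and eigenvectors themselves are chosen without any
    measurability; only the assembled tensors [f (A w)] are measurable. For each
    outcome the calculus is a finite sum over the spectrum, so that mere pointwise
    limits of [f] pass to it. *)
Lemma random_calculus_real (f : R -> R) :
  random_tensor (calculus (real_complex R)) -> measurable_fun [set: R] f ->
  random_tensor (calculus (fun x => (f x)%:C)).
Proof.
move=> mid; move: f; apply: borel_functions_smallest.
- exact: mid.
- move=> k; rewrite (_ : calculus _ = fun w => k%:C *: calculus (fun=> 1) w).
    apply: random_tensorZ; rewrite (funext calculus1); exact: random_tensor_cst.
  by apply/funext => w; rewrite -calculusZ mulr1.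
- move=> f g mf mg.
  rewrite (_ : calculus _ = fun w => calculus (fun x => (f x)%:C) w +
      calculus (fun x => (g x)%:C) w); first exact: random_tensorD.
  apply/funext => w; rewrite -calculusD; congr (calculus _ w).
  by apply/funext => x; rewrite rmorphD.
- move=> f g mf mg.
  rewrite (_ : calculus _ = fun w => einstein (calculus (fun x => (f x)%:C) w)
      (calculus (fun x => (g x)%:C) w)); first exact: random_tensor_einstein.
  apply/funext => w; rewrite -calculusM; congr (calculus _ w).
  by apply/funext => x; rewrite rmorphM.
- move=> h f mh hf ij.
  have calcE (g : R -> R) w : 
     calculus (fun x => (g x)%:C) w ij =
     \sum_(k < D) (g (lam w k))%:C * touter (U w k) ij.
    by rewrite sum_ffunE; apply: eq_bigr => k _; rewrite ffunE.
  have ReE (g : R -> R) w : complex.Re (calculus (fun x => (g x)%:C) w ij) =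
     \sum_(k < D) g (lam w k) * complex.Re (touter (U w k) ij).
    rewrite calcE (raddf_sum (@complex.Re R)); apply: eq_bigr => k _.
    by case: (touter _ _) => a b /=; rewrite mul0r subr0.
  have ImE (g : R -> R) w : complex.Im (calculus (fun x => (g x)%:C) w ij) =
     \sum_(k < D) g (lam w k) * complex.Im (touter (U w k) ij).
    rewrite calcE (raddf_sum (@complex.Im R)); apply: eq_bigr => k _.
    by case: (touter _ _) => a b /=; rewrite mul0r addr0.
  split; [apply: (@measurable_fun_cvg _ _ _ _
      (fun n w => complex.Re (calculus (fun x => (h n x)%:C) w ij)))
    |apply: (@measurable_fun_cvg _ _ _ _
      (fun n w => complex.Im (calculus (fun x => (h n x)%:C) w ij)))].
  + by move=> n; have [] := mh n ij.
  + move=> w _; rewrite ReE; under eq_fun do rewrite ReE.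
    by apply: cvg_big => [|k _]; [exact: add_continuous|apply: cvgMl; exact: hf].
  + by move=> n; have [] := mh n ij.
  + move=> w _; rewrite ImE; under eq_fun do rewrite ImE.
    by apply: cvg_big => [|k _]; [exact: add_continuous|apply: cvgMl; exact: hf].
Qed.

Lemma random_calculus (f : R -> C) :
  random_tensor (calculus (real_complex R)) ->
  measurable_fun [set: R] (fun x => complex.Re (f x)) ->
  measurable_fun [set: R] (fun x => complex.Im (f x)) ->
  random_tensor (calculus f).
Proof.
move=> mid mr mi.
rewrite (_ : calculus f = fun w => calculus (fun x => (complex.Re (f x))%:C) w +
    'i%C *: calculus (fun x => (complex.Im (f x))%:C) w).
  apply: random_tensorD; first exact: random_calculus_real.
  by apply: random_tensorZ; exact: random_calculus_real.
apply/funext => w; rewrite -calculusZ -calculusD; congr (calculus _ w).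
by apply/funext => x; rewrite -complexE.
Qed.
End Calculus.

Lemma random_eigen_decomposition (A : T -> tensor R I) :
  (forall w, thermitian (A w)) ->
  exists lam U, forall w, eigen_decomposition (A w) (lam w) (U w).
Proof.
move=> hA; have h w : exists p, eigen_decomposition (A w) p.1 p.2.
  by have [l [u e]] := eigen_decomposition_exists (hA w); exists (l, u).
have [p hp] := choice h.
by exists (fun w => (p w).1), (fun w => (p w).2).
Qed.

Lemma measurable_cpow (p : R) :
  measurable_fun [set: R] (fun x => complex.Re (cpow x p)) /\
  measurable_fun [set: R] (fun x => complex.Im (cpow x p)).
Proof.
have mle : measurable_fun [set: R] (fun x : R => 0 <= x).
  exact: measurable_fun_ler.
have mNpow : measurable_fun [set: R] (fun x : R => (- x) `^ p).
  exact: (measurableT_comp (measurable_powR p)).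
split.
- rewrite (_ : (fun _ => _) =
      fun x => if 0 <= x then x `^ p else (- x) `^ p * cos (pi * p)).
    apply: measurable_fun_ifT => //.
    exact: measurable_funM.
  by apply/funext => x; rewrite /cpow; case: ifP => //= _; rewrite mul0r subr0.
- rewrite (_ : (fun _ => _) =
      fun x => if 0 <= x then 0 else (- x) `^ p * sin (pi * p)).
    apply: measurable_fun_ifT => //; exact: measurable_funM.
  by apply/funext => x; rewrite /cpow; case: ifP => //= _; rewrite mul0r addr0.
Qed.

Lemma random_tpow (A : T -> tensor R I) p : random_hermitian A ->
  random_tensor (fun w => tpow (A w) p).
Proof.
move=> [mA hA]; have [lam [U hU]] := random_eigen_decomposition hA.
have uU w : ucols (U w) \is unitarymx by have /eigen_decompositionP[] := hU w.
rewrite (_ : (fun w => _) = calculus lam U (fun x => cpow x p)); last first.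
  by apply/funext => w; rewrite (tpowE p (hU w)).
have [mr mi] := measurable_cpow p; apply: random_calculus => //.
rewrite (_ : calculus _ _ _ = A)//.
by apply/funext => w; have [_ ->] := hU w.
Qed.

(** The norm exceeds [s] when some eigenvalue of [Y^H Y] lies in the set [E] of
    numbers with square root above [s], that is, when the trace of [\1_E (Y^H Y)],
    which counts these eigenvalues, is positive. This trace is measurable by the
    functional calculus. *)
Lemma measurable_tnorm (Y : T -> tensor R I) : (0 < D)%N -> random_tensor Y ->
  measurable_fun [set: T] (fun w => tnorm (Y w)).
Proof.
move=> D_gt0 mY.
have mG : random_tensor (fun w => tgram (Y w)).
  by apply: random_tensor_einstein => //; exact: random_tensor_adjoint.
have [mu [U hU]] := random_eigen_decomposition (fun w => tgram_hermitian (Y w)).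
have uU w : ucols (U w) \is unitarymx by have /eigen_decompositionP[] := hU w.
have mid : random_tensor (calculus mu U (real_complex R)).
  rewrite (_ : calculus _ _ _ = (fun w => tgram (Y w)))//.
  by apply/funext => w; have [_ ->] := hU w.
move=> mT; apply: (measurability _ (RGenOInfty.measurableE R)) => //.
move=> /= _ [_ [s ->] <-].
pose E := [set x : R | s < Num.sqrt x].
have mE : measurable E.
  have msqrt : measurable_fun [set: R] (@Num.sqrt R).
    by apply: continuous_measurable_fun; exact: sqrt_continuous.
  have := msqrt measurableT _ (measurable_itv (`]s, +oo[%R)).
  rewrite setTI; congr measurable; apply/seteqP; split => x /=;
    by rewrite in_itv/= andbT.
have := random_calculus_real uU mid (measurable_indic mE).
move=> mf.
pose tr w : R := \sum_(k < D) complex.Re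
  (calculus mu U (fun x => (\1_E x)%:C) w (tidx k, tidx k)).
have mtr : measurable_fun [set: T] tr.
  by apply: measurable_sum => k; have [] := mf (tidx k, tidx k).
have trE w : tr w = \sum_(k < D) \1_E (mu w k).
  have -> : tr w = complex.Re (\tr (tmx (calculus mu U (fun x => (\1_E x)%:C) w))).
    rewrite /mxtrace (raddf_sum (@complex.Re R)).
    by apply: eq_bigr => k _; rewrite mxE.
  rewrite tmx_calculus mxtrace_mulC mulmxA (unitary_tCK (uU w)) mul1mx.
  rewrite mxtrace_diag (raddf_sum (@complex.Re R)).
  by apply: eq_bigr => k _; rewrite mxE.
rewrite (_ : _ `&` _ = tr @^-1` `]0, +oo[%classic).
  by rewrite -[X in measurable X]setTI; apply: mtr => //; exact: measurable_itv.
apply/seteqP; split => w /=; rewrite !in_itv/= !andbT trE.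
  move=> [_]; have [_ [k ->]] := tnorm_attained D_gt0 (hU w).
  move=> sk; rewrite (bigD1 k)//= ltr_pwDl//.
    by rewrite indicE mem_set.
  by apply: sumr_ge0 => j _.
move=> h; split=> //.
have [k Ek] : exists k, E (mu w k).
  apply: contrapT => /forallNP h'; move: h; rewrite big1 ?ltxx// => k _.
  by rewrite indicE memNset.
have [ub _] := tnorm_attained D_gt0 (hU w).
exact: lt_le_trans (ub k).
Qed.
End RandomTensors.

(** * A one-dimensional Sobolev inequality *)

Section SobolevBound.
Context {R : realType}.
Local Notation mu := (@lebesgue_measure R).
Implicit Types f : R -> R.

Lemma L2norm_cases f :
  (L2norm f = +oo%E) \/
  (exists j, [/\ 0 <= j, (\int[mu]_x (f x ^+ 2)%:E)%E = j%:E &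
    L2norm f = (Num.sqrt j)%:E]).
Proof.
have -> : L2norm f = ((\int[mu]_x (f x ^+ 2)%:E) `^ 2^-1)%E.
  rewrite /L2norm unlock; congr (_ `^ _)%E; apply: eq_integral => x _ /=.
  by rewrite powR_mulrn// real_normK// num_real.
have : (0 <= \int[mu]_x (f x ^+ 2)%:E)%E.
  by apply: integral_ge0 => x _; rewrite lee_fin sqr_ge0.
case: (\int[mu]_x (f x ^+ 2)%:E)%E => [j|_|//].
  rewrite lee_fin => j0; right; exists j.
  by rewrite poweR_EFin powR12_sqrt.
by left; rewrite poweRyr// invr_neq0.
Qed.

Lemma L2norm_ge0 f : (0 <= L2norm f)%E.
Proof. exact: Lnorm_ge0. Qed.

(** Otherwise [f ^ 2 >= e] on the interval [[t - L, t[], whose contribution [e L]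
    to the integral exceeds [j] for [L = j / e + 1]. *)
Lemma square_integrable_small f j (e t : R) : continuous f ->
  (\int[mu]_x (f x ^+ 2)%:E)%E = j%:E -> 0 < e ->
  exists2 s, s < t & f s ^+ 2 < e.
Proof.
move=> cf hj e0.
have mf2 : measurable_fun [set: R] (fun x => (f x ^+ 2)%:E).
  apply/measurable_EFinP; apply: measurable_funX.
  exact: continuous_measurable_fun.
have f2_ge0 x : (0 <= (f x ^+ 2)%:E)%E by rewrite lee_fin sqr_ge0.
have j0 : 0 <= j by rewrite -lee_fin -hj integral_ge0.
apply: contrapT => h.
have fe s : s < t -> e <= f s ^+ 2.
  by move=> st; rewrite leNgt; apply/negP => fs; apply: h; exists s.
pose L := j / e + 1.
have L0 : 0 < L by rewrite ltr_wpDl// divr_ge0// ltW.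
have : (\int[mu]_(x in `[(t - L)%R, t[) e%:E <= j%:E)%E.
  rewrite -hj; apply: (@le_trans _ _ (\int[mu]_(x in `[(t - L)%R, t[) (f x ^+ 2)%:E)%E).
    apply: ge0_le_integral => //.
    - by move=> x _; rewrite lee_fin ltW.
    - exact: measurable_funTS.
    - by move=> x /=; rewrite in_itv/= => /andP[_ xt]; rewrite lee_fin fe.
  exact: ge0_subset_integral.
rewrite integral_cst//= lebesgue_measure_itv/= lte_fin ltrBlDr ltrDl L0.
rewrite -EFinB opprB addrC subrK -EFinM lee_fin /L mulrDr mulr1 mulrC divfK ?gt_eqF//.
by rewrite gerDl leNgt e0.
Qed.

(** The derivative [2 f f'] of [f ^ 2] is at most [c f ^ 2 + f' ^ 2 / c], the
    difference being [(c f - f') ^ 2 / c]. *)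
Lemma sqr_increment_le f (f' : R -> R) (s t c : R) :
  (forall x : R, is_derive x 1 f (f' x)) ->
  continuous f' -> s < t -> 0 < c ->
  ((f t ^+ 2 - f s ^+ 2)%:E <=
   \int[mu]_(x in `[s, t]) (c * f x ^+ 2 + f' x ^+ 2 / c)%:E)%E.
Proof.
move=> df cf' st c0.
have cf : continuous f.
  by move=> x; apply/differentiable_continuous/derivable1_diffP; exact: ex_derive.
pose g x := f x * f' x *+ 2.
have dF (x : R) : is_derive x 1 (fun x => f x ^+ 2) (g x).
  have := is_deriveX 2 (df x); rewrite (_ : f ^+ 2 = (fun x => f x ^+ 2)); last first.
    by apply/funext => y; rewrite exprfctE.
  by move/is_derive_eq; apply; rewrite /g expr1 -[LHS]/(_ * _) -mulrA mulr_natl.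
have cF : continuous (fun x => f x ^+ 2).
  by move=> x; apply/differentiable_continuous/derivable1_diffP; exact: ex_derive.
have cg : continuous g.
  move=> x; rewrite /g (_ : (fun _ => _) = fun x => 2 * (f x * f' x)); last first.
    by apply/funext => y; rewrite mulr_natl.
  by apply: cvgMr; apply: cvgM; [exact: cf|exact: cf'].
have ch : continuous (fun x => c * f x ^+ 2 + f' x ^+ 2 / c).
  move=> x; apply: cvgD.
    apply: cvgMr; apply: (@continuous_comp _ _ _ f (fun y => y ^+ 2)); first exact: cf.
    exact: exprn_continuous.
  apply: cvgMl; apply: (@continuous_comp _ _ _ f' (fun y => y ^+ 2)); first exact: cf'.
  exact: exprn_continuous.
rewrite EFinB -(@continuous_FTC2 _ g (fun x => f x ^+ 2) s t st); first last.
- by move=> x _; rewrite derive1E derive_val.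
- split.
  + by move=> x _; exact: ex_derive.
  + apply: cvg_at_right_filter; exact: cF.
  + apply: cvg_at_left_filter; exact: cF.
- exact: continuous_subspaceT.
apply: le_integral => //.
- apply: continuous_compact_integrable; first exact: segment_compact.
  exact: continuous_subspaceT.
- apply: continuous_compact_integrable; first exact: segment_compact.
  exact: continuous_subspaceT.
move=> x _; rewrite lee_fin /g -subr_ge0.
have -> : c * f x ^+ 2 + f' x ^+ 2 / c - f x * f' x *+ 2 = (c * f x - f' x) ^+ 2 / c.
  by field; rewrite gt_eqF.
by rewrite divr_ge0 ?sqr_ge0// ltW.
Qed.

(** A Sobolev embedding into bounded functions with the product of the two norms
    linearized: [f t ^ 2 <= c |f|_2 ^ 2 + |f'|_2 ^ 2 / c], which is at most the
    square of the right-hand side. *)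
Lemma sobolev_pointwise f (f' : R -> R) (c t : R) :
  (forall x : R, is_derive x 1 f (f' x)) ->
  continuous f' -> 0 < c ->
  ((f t)%:E <= (Num.sqrt (2 * c))%:E * L2norm f +
               (Num.sqrt (2 / c))%:E * L2norm f')%E.
Proof.
move=> df cf' c0.
have cf : continuous f.
  by move=> x; apply/differentiable_continuous/derivable1_diffP; exact: ex_derive.
have sq1 : 0 < Num.sqrt (2 * c) by rewrite sqrtr_gt0 mulr_gt0.
have sq2 : 0 < Num.sqrt (2 / c) by rewrite sqrtr_gt0 divr_gt0.
have [->|[j [j0 hj ->]]] := L2norm_cases f.
  rewrite gt0_muley ?lte_fin// addye ?leey//.
  by rewrite -ltNye (lt_le_trans (ltNyr 0))// mule_ge0 ?lee_fin ?L2norm_ge0// ltW.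
have [->|[k [k0 hk ->]]] := L2norm_cases f'.
  by rewrite gt0_muley ?lte_fin// addey ?leey.
rewrite -!EFinM -EFinD lee_fin.
have key : f t ^+ 2 <= c * j + k / c.
  apply/ler_addgt0Pr => e e0.
  have [s st fs] := square_integrable_small t cf hj e0.
  have ft : f t ^+ 2 - f s ^+ 2 <= c * j + k / c.
    rewrite -lee_fin; apply: le_trans (sqr_increment_le df cf' st c0) _.
    have mf2 : measurable_fun [set: R] (fun x => (f x ^+ 2)%:E).
      apply/measurable_EFinP; apply: measurable_funX.
      exact: continuous_measurable_fun.
    have mf'2 : measurable_fun [set: R] (fun x => (f' x ^+ 2)%:E).
      apply/measurable_EFinP; apply: measurable_funX.
      exact: continuous_measurable_fun.
    have f2_ge0 x : (0 <= (f x ^+ 2)%:E)%E by rewrite lee_fin sqr_ge0.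
    have f'2_ge0 x : (0 <= (f' x ^+ 2)%:E)%E by rewrite lee_fin sqr_ge0.
    under eq_integral do rewrite EFinD EFinM [_ / c]mulrC [(_ * f' _ ^+ 2)%:E]EFinM.
    have i1 : (c%:E * j%:E = \int[mu]_x (c%:E * (f x ^+ 2)%:E))%E.
      by rewrite ge0_integralZl_EFin// ?hj// ltW.
    have i2 : (c^-1%:E * k%:E = \int[mu]_x (c^-1%:E * (f' x ^+ 2)%:E))%E.
      by rewrite ge0_integralZl_EFin// ?hk// invr_ge0 ltW.
    rewrite EFinD EFinM (mulrC k) EFinM i1 i2 -ge0_integralD//; last 4 first.
    - by move=> x _; rewrite mule_ge0// lee_fin ltW.
    - exact: measurable_funeM.
    - by move=> x _; rewrite mule_ge0// lee_fin invr_ge0 ltW.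
    - exact: measurable_funeM.
    apply: ge0_subset_integral => //.
      by apply: emeasurable_funD; exact: measurable_funeM.
    by move=> x _; rewrite adde_ge0// mule_ge0// lee_fin ?invr_ge0 ltW.
  by rewrite -lerBlDr (le_trans _ ft)// lerB// ltW.
have [f0|f0] := ltP (f t) 0.
  by rewrite (le_trans (ltW f0))// addr_ge0// mulr_ge0// ?sqrtr_ge0// ltW.
rewrite -(@ler_pXn2r _ 2) ?nnegrE ?addr_ge0 ?mulr_ge0 ?sqrtr_ge0//.
apply: (le_trans key).
rewrite sqrrD !exprMn !sqr_sqrtr//;
  [|by rewrite divr_ge0// ltW|by rewrite mulr_ge0// ltW].
have p1 : 0 <= c * j by rewrite mulr_ge0// ltW.
have p2 : 0 <= k / c by rewrite divr_ge0// ltW.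
have p3 : 0 <= Num.sqrt (2 * c) * Num.sqrt j * (Num.sqrt (2 / c) * Num.sqrt k).
  by rewrite !mulr_ge0 ?sqrtr_ge0.
have e1 : 2 * c * j = 2 * (c * j) by rewrite mulrA.
have e2 : 2 / c * k = 2 * (k / c) by rewrite -mulrA (mulrC c^-1).
rewrite e1 e2 mulr2n; lra.
Qed.
End SobolevBound.

(** * The multiplier g *)

Section Multiplier.
Context {R : realType}.
Implicit Types alpha beta : R.

Lemma gfun_continuously_derivable alpha beta :
  (forall x : R, is_derive x 1 (gfun alpha beta) ((gfun alpha beta)^`()%classic x)) /\
  continuous ((gfun alpha beta)^`()%classic).
Proof.
pose E (k t : R) := expR (k * t / 2).
have dE (k x : R) : is_derive x 1 (E k) (k / 2 * E k x).
  have -> : E k = expR \o (fun t => k / 2 * t).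
    by apply/funext => t /=; rewrite /E mulrAC.
  have dl : is_derive x 1 (fun t : R => k / 2 * t) (k / 2).
    have := is_deriveZ (k / 2) (is_derive_id x 1); move/is_derive_eq; apply.
    by rewrite -[LHS]/(_ * _) mulr1.
  have := is_derive1_comp (is_derive_expR _) dl; move/is_derive_eq; apply.
  by rewrite -[LHS]/(_ * _) mulrC.
have cE k : continuous (E k).
  by move=> x; apply/differentiable_continuous/derivable1_diffP; exact: ex_derive.
pose n t := E alpha t + E (- beta) t.
pose q t := E 1 t + E (-1) t.
pose n' t := alpha / 2 * E alpha t + - beta / 2 * E (- beta) t.
pose q' t := 1 / 2 * E 1 t + -1 / 2 * E (-1) t.
have q0 t : q t != 0 by rewrite gt_eqF// addr_gt0 ?expR_gt0.
have dn (x : R) : is_derive x 1 n (n' x) by exact: is_deriveD.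
have dq (x : R) : is_derive x 1 q (q' x) by exact: is_deriveD.
have gE : gfun alpha beta = n * (fun t => (q t)^-1).
  by apply/funext => t; rewrite /gfun -[RHS]/(n t / q t) /n /q /E !mul1r mulN1r.
pose g' t := n' t / q t - n t * q' t / q t ^+ 2.
have dg (x : R) : is_derive x 1 (gfun alpha beta) (g' x).
  rewrite gE; have := is_deriveM (dn x) (is_deriveV (q0 x) (dq x)).
  move/is_derive_eq; apply.
  rewrite -[LHS]/(n x * (- (q x ^+ 2)^-1 * q' x) + (q x)^-1 * n' x) /g'.
  by field.
have cn : continuous n by move=> x; apply: cvgD; exact: cE.
have cq : continuous q by move=> x; apply: cvgD; exact: cE.
have cn' : continuous n' by move=> x; apply: cvgD; apply: cvgMr; exact: cE.
have cq' : continuous q' by move=> x; apply: cvgD; apply: cvgMr; exact: cE.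
have -> : (gfun alpha beta)^`()%classic = g'.
  by apply/funext => x; rewrite derive1E derive_val.
split=> // x; apply: cvgB.
  by apply: cvgM; [exact: cn'|apply: cvgV; [exact: q0|exact: cq]].
apply: cvgM; first by apply: cvgM; [exact: cn|exact: cq'].
apply: cvgV; first by rewrite expf_neq0.
by apply: (@continuous_comp _ _ _ q (fun y => y ^+ 2));
  [exact: cq|exact: exprn_continuous].
Qed.

Lemma gfun_le_min_factor alpha beta t :
  ((gfun alpha beta t)%:E <= min_factor (gfun alpha beta))%E.
Proof.
have [dg cg] := gfun_continuously_derivable alpha beta.
apply/ereal_infP => _ [c /= c0 <-].
exact: sobolev_pointwise.
Qed.

(** Both exponents in the numerator are at most [|t| / 2]. *)
Lemma gfun_le2 alpha beta t : 0 <= alpha <= 1 -> 0 <= beta <= 1 ->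
  gfun alpha beta t <= 2.
Proof.
move=> /andP[a0 a1] /andP[b0 b1].
have e1 : 0 < expR (t / 2) by exact: expR_gt0.
have e2 : 0 < expR (- t / 2) by exact: expR_gt0.
have le_end k : -1 <= k -> k <= 1 -> expR (k * t / 2) <= expR (t / 2) + expR (- t / 2).
  move=> k0 k1; have [t0|t0] := leP 0 t.
    apply: (@le_trans _ _ (expR (t / 2))); last by rewrite lerDl ltW.
    by rewrite ler_expR ler_pM2r ?invr_gt0// -[leRHS]mul1r ler_wpM2r.
  apply: (@le_trans _ _ (expR (- t / 2))); last by rewrite lerDr ltW.
  by rewrite ler_expR ler_pM2r ?invr_gt0// -[leRHS]mulN1r ler_wnM2r// ltW.
rewrite /gfun ler_pdivrMr ?addr_gt0// mulr_natl mulr2n lerD// le_end//; lra.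
Qed.

(** A real number even when the two norms in [min_factor] are infinite. *)
Definition gsup alpha beta : R := sup (range (gfun alpha beta)).

Section Bounds.
Variables (alpha beta : R).
Hypotheses (halpha : 0 <= alpha <= 1) (hbeta : 0 <= beta <= 1).

Lemma gfun_le_gsup t : gfun alpha beta t <= gsup alpha beta.
Proof.
apply: ub_le_sup; last by exists t.
by exists 2 => _ [s _ <-]; exact: gfun_le2.
Qed.

(** The value of [gfun] at the origin. *)
Lemma gsup_ge1 : 1 <= gsup alpha beta.
Proof.
apply: le_trans (gfun_le_gsup 0).
by rewrite /gfun !(mulr0, oppr0, mul0r) expR0 divff// lt0r_neq0// addr_gt0.
Qed.

Lemma gsup_le_min_factor : ((gsup alpha beta)%:E <= min_factor (gfun alpha beta))%E.
Proof.
have := gfun_le_min_factor alpha beta.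
case: (min_factor _) => [r h|_|/(_ 0)//]; last exact: leey.
rewrite lee_fin; apply: ge_sup; first by exists (gfun alpha beta 0), 0.
by move=> _ [s _ <-]; rewrite -lee_fin.
Qed.

(** For positive [x] and [y] the quotient of the left-hand side by [x + y] is
    [gfun alpha beta (ln x - ln y)], as one sees after dividing both by the
    geometric mean of [x] and [y]. If one of them vanishes, then at most the other
    one is left, with coefficient [1]. *)
Lemma heinz_scalar (x y : R) : 0 <= x -> 0 <= y ->
  x `^ ((1 + alpha) / 2) * y `^ ((1 - alpha) / 2) +
  x `^ ((1 - beta) / 2) * y `^ ((1 + beta) / 2) <= gsup alpha beta * (x + y).
Proof.
have /andP[a0 a1] := halpha; have /andP[b0 b1] := hbeta.
have S1 := gsup_ge1.
have p0 (k : R) : -1 < k -> (1 + k) / 2 != 0.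
  by move=> k1; rewrite gt_eqF// divr_gt0//; lra.
(* The convention 0^0 = 1 matters only for k = 1, where equality holds. *)
have zero (k z : R) : 0 <= z -> 0 <= k ->
    (0 : R) `^ ((1 - k) / 2) * z `^ ((1 + k) / 2) <= z.
  move=> z0 k0; rewrite {1}/powR eqxx; have [->|k1] := eqVneq k 1.
    by rewrite subrr mul0r eqxx mul1r divff ?powRr1// pnatr_eq0.
  by rewrite mulf_eq0 invr_eq0 pnatr_eq0 orbF subr_eq0 eq_sym (negPf k1) mul0r.
rewrite le_eqVlt => /predU1P[<-|x0] y0.
  rewrite (powR0 (p0 _ _)) ?mul0r ?add0r; last by lra.
  by apply: (le_trans (zero _ _ y0 b0)); rewrite ler_peMl.
move: y0; rewrite le_eqVlt => /predU1P[<-|y0].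
  rewrite (powR0 (p0 beta _)) ?mulr0 ?addr0; last by lra.
  by rewrite mulrC; apply: (le_trans (zero _ _ (ltW x0) a0)); rewrite ler_peMl// ltW.
have -> : x `^ ((1 + alpha) / 2) * y `^ ((1 - alpha) / 2) +
    x `^ ((1 - beta) / 2) * y `^ ((1 + beta) / 2) =
    gfun alpha beta (ln x - ln y) * (x + y).
  have ex : x = expR ((ln x + ln y) / 2) * expR ((ln x - ln y) / 2).
    by rewrite -expRD -[LHS]lnK ?posrE//; congr expR; field.
  have ey : y = expR ((ln x + ln y) / 2) * expR (- (ln x - ln y) / 2).
    by rewrite -expRD -[LHS]lnK ?posrE//; congr expR; field.
  rewrite [X in _ * (X + _)]ex [X in _ * (_ + X)]ey /powR !gt_eqF// -mulrDr.
  rewrite /gfun mulrCA divfK ?gt_eqF ?addr_gt0 ?expR_gt0//.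
  by rewrite mulrDr -!expRD; congr (expR _ + expR _); field.
by rewrite ler_wpM2r ?gfun_le_gsup// addr_ge0// ltW.
Qed.
End Bounds.
End Multiplier.

(** * Norm inequality and tail bound *)

Section Pointwise.
Local Open Scope complex_scope.
Local Open Scope sesquilinear_scope.
Context {R : realType}.

(** The phase of [cpow] at a negative number has modulus [1]. *)
Lemma norm_cpow (x p : R) : `|cpow x p| = (`|x| `^ p)%:C.
Proof.
rewrite /cpow; case: (leP 0 x) => x0.
  by rewrite (ger0_norm x0) ger0_norm// ler0c powR_ge0.
rewrite normrM (ltr0_norm x0) ger0_norm ?ler0c ?powR_ge0//.
by rewrite normc_def cos2Dsin2 sqrtr1 mulr1.
Qed.

Lemma cpow_nat (x : R) (m : nat) : (odd m -> 0 <= x) ->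
  cpow x m%:R = (`|x| ^+ m)%:C.
Proof.
move=> hx; rewrite /cpow.
case: (leP 0 x) => x0; first by rewrite powR_mulrn// ger0_norm.
have modd : ~~ odd m by apply/negP => /hx; rewrite leNgt x0.
have [cs sn] : cos (pi * m%:R) = 1 :> R /\ sin (pi * m%:R) = 0 :> R.
  rewrite -[m](odd_double_half m) (negPf modd) add0n; elim: m./2 => [|k [IHc IHs]].
    by rewrite mulr0 cos0 sin0.
  have -> : pi * (k.+1.*2)%:R = pi * (k.*2)%:R + pi *+ 2 :> R.
    by rewrite doubleS !mulrS; ring.
  by rewrite cosD2pi sinD2pi.
rewrite cs sn complexr0 mulr1 powR_mulrn ?oppr_ge0 ?ltW//.
by rewrite ltr0_norm.
Qed.

Context {N : nat} {I : 'I_N -> nat}.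
Implicit Types A B X : tensor R I.

(** Entrywise comparison in a pair of eigenbases. The moduli of the fractional
    powers only involve [|a|] and [|b|], while the integer powers are nonnegative
    by parity or by the sign conditions, so that nothing cancels in
    [a ^ m + b ^ n]. *)
Lemma tnorm_heinz A B X (alpha beta : R) (m n : nat) : (0 < dimI I)%N ->
  thermitian A -> thermitian B ->
  0 <= alpha <= 1 -> 0 <= beta <= 1 ->
  (odd m -> nonneg_spectrum A) -> (odd n -> nonneg_spectrum B) ->
  tnorm (einstein (einstein (tpow A (m%:R * (1 + alpha) / 2)) X)
                  (tpow B (n%:R * (1 - alpha) / 2)) +
         einstein (einstein (tpow A (m%:R * (1 - beta) / 2)) X)
                  (tpow B (n%:R * (1 + beta) / 2)))
  <= (dimI I)%:R ^+ 2 * gsup alpha beta *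
     tnorm (einstein (tpow A m%:R) X + einstein X (tpow B n%:R)).
Proof.
move=> D_gt0 hA hB halpha hbeta Apos Bpos.
have [a [U hU]] := eigen_decomposition_exists hA.
have [b [V hV]] := eigen_decomposition_exists hB.
have [uU _] := (eigen_decompositionP A a U).1 hU.
have [uV _] := (eigen_decompositionP B b V).1 hV.
have S0 : 0 <= gsup alpha beta by apply: le_trans (gsup_ge1 halpha hbeta).
have ai i : odd m -> 0 <= a i.
  by move=> /Apos; apply; apply/(teigenvalueP _ hU); exists i.
have bj j : odd n -> 0 <= b j.
  by move=> /Bpos; apply; apply/(teigenvalueP _ hV); exists j.
apply: (tnorm_double_multiplier D_gt0 X S0 uU uV (tpowE _ hU) (tpowE _ hU)
  (tpowE _ hU) (tpowE _ hV) (tpowE _ hV) (tpowE _ hV)).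
move=> i j; rewrite (cpow_nat (ai i)) (cpow_nat (bj j)) -rmorphD.
apply: le_trans (ler_normD _ _) _.
rewrite !normrM !norm_cpow [X in _ <= _ * X]ger0_norm ?ler0c ?addr_ge0 ?exprn_ge0//.
rewrite -!rmorphM -!rmorphD lecR.
have powE (y k : R) l : `|y| `^ (l%:R * k / 2) = (`|y| ^+ l) `^ (k / 2).
  by rewrite -mulrA powRrM powR_mulrn.
rewrite (powE (a i) (1 + alpha)) (powE (b j) (1 - alpha)).
rewrite (powE (a i) (1 - beta)) (powE (b j) (1 + beta)).
by apply: heinz_scalar => //; exact: exprn_ge0.
Qed.
End Pointwise.

Lemma markov_dominated (R : realType) (d : measure_display) (T : measurableType d)
    (P : probability T R) (F V : T -> R) (k theta : R) :
  measurable_fun [set: T] F -> measurable_fun [set: T] V ->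
  (forall w, 0 <= F w) -> (forall w, 0 <= V w) -> 0 <= k -> 0 < theta ->
  (forall w, F w <= k * V w) ->
  (P [set w | (theta <= F w)%R] <= (k / theta)%:E * 'E_P[V])%E.
Proof.
move=> mF mV F0 V0 k0 th0 FV.
have mEF : measurable_fun setT (EFin \o F) by exact/measurable_EFinP.
have mEV : measurable_fun setT (EFin \o V) by exact/measurable_EFinP.
have th : (theta%:E * P [set w | (theta <= F w)%R] <= \int[P]_w (F w)%:E)%E.
  have := @le_integral_comp_abse _ _ _ P setT measurableT (EFin \o F) theta id.
  move=> /(_ (@measurable_id _ _ _) (fun r h => h) (fun x y _ _ h => h) mEF th0).
  rewrite setTI /=; under eq_integral do rewrite ger0_norm//.
  by under eq_set do rewrite ger0_norm// lee_fin.
rewrite unlock mulrC EFinM -muleA lee_pdivlMl//.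
apply: (le_trans th); rewrite -ge0_integralZl_EFin//; last first.
  by move=> w _; rewrite lee_fin.
apply: ge0_le_integral => //.
- by move=> w _; rewrite lee_fin.
- exact: measurable_funeM.
- by move=> w _; rewrite -EFinM lee_fin.
Qed.

Theorem corollary5 (R : realType) (d : measure_display) (T : measurableType d)
    (P : probability T R) (N : nat) (I : 'I_N -> nat)
    (N_gt0 : (0 < N)%N) (I_gt0 : forall k, (0 < I k)%N)
    (A B : T -> tensor R I) (X : tensor R I)
    (hA : random_hermitian A) (hB : random_hermitian B) (hX : thermitian X)
    (alpha beta : R) (halpha : 0 <= alpha <= 1) (hbeta : 0 <= beta <= 1)
    (m n : nat) (m_gt0 : (0 < m)%N) (n_gt0 : (0 < n)%N)
    (Apos : odd m -> forall w, nonneg_spectrum (A w))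
    (Bpos : odd n -> forall w, nonneg_spectrum (B w))
    (theta : R) (theta_gt0 : 0 < theta) :
  (P [set w | (theta <=
        tnorm (einstein (einstein (tpow (A w) (m%:R * (1 + alpha) / 2)) X)
                        (tpow (B w) (n%:R * (1 - alpha) / 2)) +
               einstein (einstein (tpow (A w) (m%:R * (1 - beta) / 2)) X)
                        (tpow (B w) (n%:R * (1 + beta) / 2))))%R]
   <= ((dimI I)%:R ^+ 2 / theta)%:E
      * min_factor (gfun alpha beta)
      * 'E_P[fun w => tnorm (einstein (tpow (A w) m%:R) X +
                             einstein X (tpow (B w) n%:R))%R])%E.
Proof.
have D_gt0 : (0 < dimI I)%N by rewrite /dimI prodn_gt0.
have [mA hermA] := hA; have [mB hermB] := hB.
have mX : random_tensor (fun _ : T => X) := random_tensor_cst X.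
set F := fun w => tnorm _; set Z := 'E_P[_]%E.
have mLHS p q : random_tensor
    (fun w => einstein (einstein (tpow (A w) p) X) (tpow (B w) q)).
  apply: random_tensor_einstein; last exact: random_tpow.
  by apply: random_tensor_einstein => //; exact: random_tpow.
have S0 : 0 <= gsup alpha beta by apply: le_trans (gsup_ge1 halpha hbeta).
set V := fun w => tnorm (einstein (tpow (A w) m%:R) X + einstein X (tpow (B w) n%:R)).
have mV : measurable_fun [set: T] V.
  apply: measurable_tnorm => //; apply: random_tensorD.
    by apply: random_tensor_einstein => //; exact: random_tpow.
  by apply: random_tensor_einstein => //; exact: random_tpow.
apply: le_trans (@markov_dominated _ _ _ P _ V
  ((dimI I)%:R ^+ 2 * gsup alpha beta) theta _ mV _ _ _ theta_gt0 _) _.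
- by apply: measurable_tnorm => //; apply: random_tensorD; exact: mLHS.
- by move=> w; exact: tnorm_ge0.
- by move=> w; exact: tnorm_ge0.
- by rewrite mulr_ge0.
- by move=> w; apply: tnorm_heinz => // om; [exact: Apos|exact: Bpos].
rewrite mulrAC EFinM.
apply: lee_wpmul2r; last first.
  by apply: lee_wpmul2l; [rewrite lee_fin divr_ge0// ltW|exact: gsup_le_min_factor].
by rewrite unlock; apply: integral_ge0 => w _; rewrite lee_fin; exact: tnorm_ge0.
Qed.
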